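(* Let $X$ be a real Hilbert space of dimension at least $2$. For every closed and convex subset $\Omega \subseteq X$ with $\Omega \neq X$, the limit $$\lim_{\varepsilon \to 0,\ \varepsilon>0} \frac{\delta_\Omega(\varepsilon)}{\varepsilon^2}$$ exists in $\mathbb{R}$.
   Context: $X$ is a real Hilbert space of dimension at least $2$ with norm $\|\cdot\|$. For $c\in X$ and $\delta>0$, $\overline B(c,\delta)$ is the closed ball of radius $\delta$ centered at $c$, with the convention $\overline B(c,0)=\{c\}$. For $\Omega\subseteq X$ the modulus of convexity $\delta_\Omega$ is defined for $0\le \varepsilon<\infty$ by $$\delta_\Omega(\varepsilon)=\sup\{\delta\ge 0 \mid x,y\in\Omega,\ \|x-y\|=\varepsilon \Longrightarrow \overline B((x+y)/2,\delta)\subseteq\Omega\},$$ where the implication is required for all such $x,y$.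
   Formalization: Ω is additionally assumed to contain two distinct points: for Ω empty or a singleton the implication defining δ_Ω(ε) is vacuous for every ε > 0, so δ_Ω(ε) = +∞ and the limit does not exist in ℝ. *)

(* Defs.v *)
From mathcomp Require Import all_boot all_order all_algebra.
From mathcomp Require Import all_classical all_reals all_analysis.

Set Implicit Arguments.
Unset Strict Implicit.
Unset Printing Implicit Defensive.

Import Order.TTheory GRing.Theory Num.Theory.
Import numFieldNormedType.Exports.

Local Open Scope classical_set_scope.
Local Open Scope ring_scope.

Definition dim_ge2 (R : realType) (X : lmodType R) : Prop :=
  exists u v : X, forall a b : R, a *: u + b *: v = 0 -> a = 0 /\ b = 0.

(* The supremum is taken in the extended reals: it is +oo when no two points
   of Omega are at distance e.  The ball is [closed_ball_ Num.norm c d], i.e.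
   {z | `|c - z| <= d}, which is {c} for d = 0; the library's [closed_ball c d]
   is the closure of the open ball, hence empty for d = 0. *)
Definition modulus_of_convexity (R : realType) (X : normedModType R)
    (Omega : set X) (e : R) : \bar R :=
  ereal_sup [set d%:E | d in [set d : R | 0 <= d /\
    forall x y : X, Omega x -> Omega y -> `|x - y| = e ->
      closed_ball_ Num.norm (2^-1 *: (x + y)) d `<=` Omega]].

(* Main.v *)
Require Import Defs.
From mathcomp Require Import all_boot all_order all_algebra.
From mathcomp Require Import all_classical all_reals all_analysis.
From mathcomp Require Import ring lra.

Import Order.TTheory GRing.Theory Num.Theory.
Import numFieldNormedType.Exports.

Local Open Scope classical_set_scope.
Local Open Scope ring_scope.

(** Say that Omega has margin d at scale e when the ball of radius d about the
    midpoint of any chord of length e stays in Omega; the modulus at e is the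
    supremum of such d.  The theorem rests on two facts.

    Margins propagate from small scales to larger ones with no loss in the
    ratio d / e^2, asymptotically ([midpoint_balls_eventually]).  Let margin
    c * e^2 hold at some arbitrarily small scales e, and take a chord [x, y]
    of length l and a vector u of norm at most 1.  For s >= 0 the parabola
    t |-> (1 - t) x + t y + s t (1 - t) u starts, at s = 0, as the chord
    itself.  Sample it at t = i / N.  The midpoint of the neighbours of a
    sample lies s / N^2 behind it in the direction u, while these neighbours
    are at least 2 (l - s) / N apart.  If N is the largest even number for
    which this distance is at least e, each interior sample is inside Omega
    with room to spare as long as s / N^2 < c * e^2, that is,
    s < 4 c (l - s)^2 up to an error that vanishes with e; so s can be raised
    step by step up to that bound, the whole sampled parabola remaining in
    Omega.  At t = 1/2 this gives margin s / 4 at scale l, where s / 4 is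
    c * l^2 up to a factor 1 + O(l).

    The ratio d / e^2 is bounded at small scales ([midpoint_balls_le_sqr]).
    This is where the inner product and dimension at least 2 enter: in a ball
    of maximal radius r about an interior point p of Omega, a chord of length
    l perpendicular to the segment from p to an almost nearest point outside
    Omega has its midpoint within about l^2 / (4 r) of that outside point.

    Hence the supremum of the c for which margin c * e^2 holds at arbitrarily
    small e is finite, and by the first fact it is a limit rather than merely
    an upper limit. *)

(** * Margins of midpoints *)

Definition midpoint_balls {R : realType} {X : normedModType R}
    (Omega : set X) (e d : R) : Prop :=
  forall x y : X, Omega x -> Omega y -> `|x - y| = e ->
    closed_ball_ Num.norm (2^-1 *: (x + y)) d `<=` Omega.

(** Identities between combinations of three fixed vectors reduce, through the
    lemmas below, to identities between scalar coefficients. *)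
Definition lin3 {R : realType} {X : normedModType R} (x y z : X) (a b c : R) :=
  a *: x + b *: y + c *: z.

Lemma lin3D {R : realType} {X : normedModType R} (x y z : X) a b c a' b' c' :
  lin3 x y z a b c + lin3 x y z a' b' c' =
  lin3 x y z (a + a') (b + b') (c + c').
Proof. by rewrite /lin3 !scalerDl addrACA (addrACA (a *: x)). Qed.

Lemma lin3Z {R : realType} {X : normedModType R} (x y z : X) k a b c :
  k *: lin3 x y z a b c = lin3 x y z (k * a) (k * b) (k * c).
Proof. by rewrite /lin3 !scalerDr !scalerA. Qed.

Lemma lin3N {R : realType} {X : normedModType R} (x y z : X) a b c :
  - lin3 x y z a b c = lin3 x y z (- a) (- b) (- c).
Proof. by rewrite /lin3 !opprD !scaleNr. Qed.

Lemma convex_set_comb {R : realType} {X : normedModType R} (Omega : set X)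
    x y (t : R) :
  convex_set Omega -> Omega x -> Omega y -> 0 <= t -> t <= 1 ->
  Omega (t *: x + (1 - t) *: y).
Proof.
move=> cO Ox Oy t0 t1.
have := cO x y (Itv01 t0 t1); rewrite !inE; exact.
Qed.

Lemma midpoint_balls0 {R : realType} {X : normedModType R} (Omega : set X) e :
  convex_set Omega -> midpoint_balls Omega e 0.
Proof.
move=> cO x y Ox Oy _ z; rewrite /closed_ball_/= normr_le0 subr_eq0 => /eqP <-.
have -> : 2^-1 *: (x + y) = 2^-1 *: x + (1 - 2^-1) *: y.
  by rewrite scalerDr; congr (_ + _ *: _); field.
by apply: convex_set_comb => //; lra.
Qed.

Lemma midpoint_balls_le {R : realType} {X : normedModType R} (Omega : set X)
    (e d d' : R) :
  d' <= d -> midpoint_balls Omega e d -> midpoint_balls Omega e d'.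
Proof.
move=> dd' He x y Ox Oy xy z zd; apply: (He x y) => //.
exact: le_trans zd dd'.
Qed.

(** A longer chord contains a chord of length exactly e with the same
    midpoint. *)
Lemma midpoint_balls_longer {R : realType} {X : normedModType R}
    (Omega : set X) (e d : R) x y :
  convex_set Omega -> midpoint_balls Omega e d -> 0 < e ->
  Omega x -> Omega y -> e <= `|x - y| ->
  closed_ball_ Num.norm (2^-1 *: (x + y)) d `<=` Omega.
Proof.
move=> cO He e0 Ox Oy exy.
have n0 : 0 < `|x - y| by exact: lt_le_trans exy.
pose k := e / `|x - y|.
have k0 : 0 <= k by rewrite divr_ge0// ltW.
have k1 : k <= 1 by rewrite ler_pdivrMr// mul1r.
pose x' := lin3 x y 0 ((1 + k) / 2) (1 - (1 + k) / 2) 0.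
pose y' := lin3 x y 0 ((1 - k) / 2) (1 - (1 - k) / 2) 0.
have Ox' : Omega x'.
  by rewrite /x' /lin3 scaler0 addr0; apply: convex_set_comb => //; lra.
have Oy' : Omega y'.
  by rewrite /y' /lin3 scaler0 addr0; apply: convex_set_comb => //; lra.
have -> : 2^-1 *: (x + y) = 2^-1 *: (x' + y').
  rewrite lin3D /lin3 scaler0 addr0; congr (_ *: _).
  by rewrite -[x in LHS]scale1r -[y in LHS]scale1r; congr (_ *: _ + _ *: _);
    field.
apply: He => //.
have -> : x' - y' = k *: (x - y).
  rewrite lin3N lin3D /lin3 scaler0 addr0 scalerBr -scaleNr.
  by congr (_ *: _ + _ *: _); field.
by rewrite normrZ ger0_norm// mulfVK// gt_eqF.
Qed.

(** * From small scales to larger scales *)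

(** The parameter s is raised from 0 in steps of eta = d - s / N^2.  If the
    samples for the parameter s'' are in Omega, the midpoint of two samples
    adjacent to a third one is the centre of a ball of radius d in Omega, and
    the third sample for any parameter in [s'', s'' + eta] is in that ball.
    The vector u is not assumed orthogonal to the chord, which is why the
    distance of the neighbours is estimated by |x - y| - s; this costs
    nothing asymptotically, as s will be of order |x - y|^2. *)
Lemma discrete_parabola_sub {R : realType} {X : normedModType R}
    (Omega : set X) (e d s : R) (N : nat) (x y u : X) :
  convex_set Omega -> midpoint_balls Omega e d -> 0 < e ->
  Omega x -> Omega y -> `|u| <= 1 -> 0 <= s -> (0 < N)%N ->
  e <= 2 / N%:R * (`|x - y| - s) -> s / N%:R ^+ 2 < d ->
  forall i : nat, (i <= N)%N -> let t := i%:R / N%:R in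
    Omega (lin3 x y u (1 - t) t (s * (t * (1 - t)))).
Proof.
move=> cO He e0 Ox Oy u1 s0 N0 eN sN.
have N0r : 0 < N%:R :> R by rewrite ltr0n.
pose h : R := N%:R^-1.
have h0 : 0 < h by rewrite invr_gt0.
have sh : s * h ^+ 2 < d by rewrite /h exprVn.
pose eta := d - s * h ^+ 2.
have eta0 : 0 < eta by rewrite subr_gt0.
suff main : forall (k : nat) (s' : R), 0 <= s' -> s' <= s -> s' <= k%:R * eta ->
    forall i : nat, (i <= N)%N -> let t := i%:R / N%:R in
    Omega (lin3 x y u (1 - t) t (s' * (t * (1 - t)))).
  have /andP[_ sk] := truncn_itv (divr_ge0 s0 (ltW eta0)).
  apply: (main (Num.truncn (s / eta)).+1) => //.
  by rewrite -ler_pdivrMr// ltW.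
elim=> [|k IH] s' s'0 s's s'k i iN t.
  have -> : s' = 0 by apply/eqP; rewrite eq_le s'0 andbT; rewrite mul0r in s'k.
  rewrite mul0r /lin3 scale0r addr0 addrC -[X in X *: x]/(1 - t).
  apply: convex_set_comb => //.
    by rewrite divr_ge0.
  by rewrite ler_pdivrMr// mul1r ler_nat.
have [i0|i0] := posnP i.
  by rewrite /t i0 mul0r mul0r mulr0 subr0 /lin3 scale1r !scale0r !addr0.
move: iN; rewrite leq_eqVlt => /predU1P[iN|iN].
  rewrite /t iN divff ?gt_eqF// subrr !mulr0 /lin3 scale1r !scale0r.
  by rewrite add0r addr0.
(* s'' is the previous parameter: at most eta below s', but nonnegative *)
pose s'' := Num.max 0 (s' - eta).
have s''0 : 0 <= s'' by rewrite le_max lexx.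
have s''s' : s'' <= s' by rewrite ge_max s'0 gerBl ltW.
have s''k : s'' <= k%:R * eta.
  rewrite ge_max; apply/andP; split; first by rewrite mulr_ge0// ltW.
  rewrite lerBlDr.
  by move: s'k; rewrite -natr1 mulrDl mul1r.
have s''eta : s' <= s'' + eta by rewrite -lerBlDr le_max lexx orbT.
have tE : t = i%:R * h by [].
have t0 : 0 <= t by rewrite divr_ge0.
have t1 : t <= 1 by rewrite ler_pdivrMr// mul1r ler_nat ltnW.
have tp : i.+1%:R / N%:R = t + h :> R by rewrite -natr1 mulrDl mul1r.
have tm : i.-1%:R / N%:R = t - h :> R.
  by rewrite tE -[in RHS](prednK i0) -natr1 mulrDl mul1r addrK.
have := IH s'' s''0 (le_trans s''s' s's) s''k i.-1
  (leq_trans (leq_pred _) (ltnW iN)).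
have := IH s'' s''0 (le_trans s''s' s's) s''k i.+1 iN.
rewrite /= tp tm; set p := lin3 _ _ _ _ _ _; set m := lin3 _ _ _ _ _ _.
move=> Op Om.
apply: (midpoint_balls_longer Omega e d m p) => //.
  have -> : m - p = (2 * h) *: (x - y) + (s'' * (2 * h * (2 * t - 1))) *: u.
    rewrite scalerBr -scaleNr lin3N lin3D /lin3.
    by congr (_ *: _ + _ *: _ + _ *: _); ring.
  apply: (le_trans eN); rewrite -[2 / _]/(2 * h).
  apply: le_trans (lerB_normD _ _).
  rewrite (normrZ _ (x - y)) (normrZ _ u) ger0_norm; last first.
    by rewrite mulr_ge0// ltW.
  rewrite mulrBr lerD2l lerN2.
  have : `|s'' * (2 * h * (2 * t - 1))| <= 2 * h * s.
    have -> : s'' * (2 * h * (2 * t - 1)) = (2 * h * s'') * (2 * t - 1) by ring.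
    rewrite normrM -[leRHS]mulr1 ler_pM//.
      rewrite ger0_norm; last by rewrite !mulr_ge0// ltW.
      by rewrite ler_pM2l ?mulr_gt0// (le_trans s''s').
    by rewrite ler_norml; apply/andP; split; lra.
  by move=> H; rewrite -[leRHS]mulr1 ler_pM.
rewrite /closed_ball_/=.
have -> : 2^-1 *: (m + p) - lin3 x y u (1 - t) t (s' * (t * (1 - t))) =
    (- (s'' * h ^+ 2 + (s' - s'') * (t * (1 - t)))) *: u.
  rewrite lin3D lin3Z lin3N lin3D /lin3.
  set a := (X in X *: x); set b := (X in X *: y).
  have -> : a = 0 by rewrite /a; field.
  have -> : b = 0 by rewrite /b; field.
  by rewrite !scale0r !add0r; congr (_ *: _); field.
rewrite normrZ normrN ger0_norm; last first.
  by rewrite addr_ge0 ?mulr_ge0// ?sqr_ge0//; lra.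
rewrite (@le_trans _ _ (s'' * h ^+ 2 + (s' - s'') * (t * (1 - t))))//.
  rewrite -[leRHS]mulr1 ler_wpM2l// addr_ge0 ?mulr_ge0// ?sqr_ge0//; lra.
have q1 : (s' - s'') * (t * (1 - t)) <= s' - s''.
  rewrite -[leRHS]mulr1 ler_wpM2l//; [lra|nra].
have q2 : s'' * h ^+ 2 <= s * h ^+ 2.
  by rewrite ler_wpM2r ?sqr_ge0// (le_trans s''s').
have q3 : s' - s'' <= eta by lra.
by rewrite /eta in q3; lra.
Qed.

Definition frequent_margin {R : realType} {X : normedModType R}
    (Omega : set X) (c : R) : Prop :=
  forall eta, 0 < eta ->
    exists e, [/\ 0 < e, e < eta & midpoint_balls Omega e (c * e ^+ 2)].

(** The parabola with parameter s reaches height s / 4 above the midpoint of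
    its chord; letting u range over the unit ball, its apexes fill the ball of
    radius s / 4.  The strict inequality leaves room to choose e so small that
    rounding (l - s) / e down to an integer is harmless. *)
Lemma midpoint_balls_of_frequent {R : realType} {X : normedModType R}
    (Omega : set X) (c l s : R) :
  convex_set Omega ->
  frequent_margin Omega c ->
  0 < s -> s < l -> s < 4 * c * (l - s) ^+ 2 ->
  midpoint_balls Omega l (s / 4).
Proof.
move=> cO Hc s0 sl sc x y Ox Oy xy z; rewrite /closed_ball_/= => zd.
set a := l - s in sc.
have a0 : 0 < a by rewrite /a; lra.
have c0 : 0 < c by have := sqr_ge0 a; nra.
(* the second bound gives s < 4 * c * (a - e) ^+ 2 *)
pose eta := Num.min a ((4 * c * a ^+ 2 - s) / (8 * c * a)).
have eta0 : 0 < eta.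
  rewrite lt_min a0/= divr_gt0//; first by lra.
  by rewrite !mulr_gt0.
have [e [e0 eeta He]] := Hc eta eta0.
have ea : e < a by move: eeta; rewrite lt_min => /andP[].
have ec : e * (8 * c * a) < 4 * c * a ^+ 2 - s.
  move: eeta; rewrite lt_min => /andP[_].
  by rewrite ltr_pdivlMr// !mulr_gt0.
(* with k = truncn (a / e) the parabola is sampled at 2 * k + 1 points; an
   even number of intervals puts a sample at the apex *)
have /andP[k1 k2] := truncn_itv (divr_ge0 (ltW a0) (ltW e0)).
set k := Num.truncn _ in k1 k2.
move: k1 k2; rewrite ler_pdivlMr// ltr_pdivrMr// -natr1 mulrDl mul1r => k1 k2.
have k0 : (0 < k)%N.
  rewrite lt0n; apply/eqP => k0; move: k2; rewrite k0 mul0r; lra.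
have k0r : 0 < k%:R :> R by rewrite ltr0n.
have N0r : 0 < (k.*2)%:R :> R by rewrite ltr0n double_gt0.
have kE : (k.*2)%:R = 2 * k%:R :> R by rewrite -muln2 natrM mulrC.
pose u := (4 / s) *: (z - 2^-1 *: (x + y)).
have u1 : `|u| <= 1.
  rewrite normrZ ger0_norm; last by rewrite divr_ge0// ltW.
  by rewrite distrC mulrC mulrA ler_pdivrMr// mul1r -ler_pdivlMr.
have := discrete_parabola_sub Omega e (c * e ^+ 2) s k.*2 x y u cO He e0 Ox Oy
  u1 (ltW s0) _ _ _ k _.
rewrite double_gt0 xy -/a /=.
have -> : k%:R / (k.*2)%:R = 2^-1 :> R.
  by rewrite kE; field; rewrite gt_eqF.
have -> : lin3 x y u (1 - 2^-1) 2^-1 (s * (2^-1 * (1 - 2^-1))) = z.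
  have -> : 1 - 2^-1 = 2^-1 :> R by field.
  rewrite /lin3 -scalerDr /u scalerA.
  have -> : s * (2^-1 / 2) * (4 / s) = 1 by field; rewrite gt_eqF.
  by rewrite scale1r addrC subrK.
apply => //.
- rewrite kE.
  have -> : 2 / (2 * k%:R) * a = a / k%:R by field; rewrite gt_eqF.
  by rewrite ler_pdivlMr// mulrC.
- rewrite ltr_pdivrMr ?exprn_gt0// kE.
  suff : 4 * c * (a - e) ^+ 2 <= 4 * c * (k%:R * e) ^+ 2 by nra.
  rewrite ler_wpM2l ?mulr_ge0//; first lra.
  by rewrite ler_sqr ?nnegrE; lra.
- by rewrite -addnn leq_addr.
Qed.

(** For the parabola parameter s = 4 c l^2, which makes s / 4 = c * l^2, the
    condition s < 4 c1 (l - s)^2 reads c < c1 (1 - 4 c l)^2: it holds for all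
    small l because c < c1. *)
Lemma midpoint_balls_eventually {R : realType} {X : normedModType R}
    (Omega : set X) (c c1 : R) :
  convex_set Omega ->
  frequent_margin Omega c1 ->
  0 < c -> c < c1 ->
  exists2 eta, 0 < eta & forall l, 0 < l -> l < eta ->
    midpoint_balls Omega l (c * l ^+ 2).
Proof.
move=> cO Hc1 c0 cc1; have c10 : 0 < c1 by exact: lt_trans cc1.
exists ((c1 - c) / (8 * c * c1)).
  by rewrite divr_gt0 ?subr_gt0 ?mulr_gt0.
move=> l l0; rewrite ltr_pdivlMr ?mulr_gt0// => ll.
have l1 : 8 * c * l < 1.
  have : c1 * (8 * c * l) < c1 * 1 by lra.
  by rewrite ltr_pM2l.
have -> : c * l ^+ 2 = (4 * c * l ^+ 2) / 4 by field.
apply: (midpoint_balls_of_frequent Omega c1) => //.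
- by rewrite !mulr_gt0 ?exprn_gt0.
- have : l * (4 * c * l) < l * 1 by rewrite ltr_pM2l//; lra.
  by rewrite mulr1 expr2; lra.
have -> : 4 * c1 * (l - 4 * c * l ^+ 2) ^+ 2 =
    4 * l ^+ 2 * (c1 * (1 - 4 * c * l) ^+ 2) by ring.
have -> : 4 * c * l ^+ 2 = 4 * l ^+ 2 * c by ring.
rewrite ltr_pM2l ?mulr_gt0 ?exprn_gt0//.
have : 0 <= c1 * (4 * c * l) ^+ 2 by rewrite mulr_ge0 ?sqr_ge0// ltW.
by nra.
Qed.

(** * The quadratic upper bound in a Hilbert space *)

Lemma exists_orthogonal_unit {R : realType} {X : normedModType R}
    (dot : {dot X for idfun}) (n : X) :
  (forall x : X, `|x| ^+ 2 = dot x x) -> dim_ge2 X ->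
  exists v, `|v| = 1 /\ dot n v = 0.
Proof.
move=> nd [a [b ab]].
suff [v [v0 nv]] : exists v : X, v != 0 /\ dot n v = 0.
  exists (`|v|^-1 *: v); split.
    by rewrite normrZ normfV normr_id mulVf// normr_eq0.
  by rewrite linearZr_LR /= nv mulr0.
pose v := dot n b *: a + (- dot n a) *: b.
have [v0|v0] := eqVneq v 0; last first.
  exists v; split=> //.
  by rewrite linearDr !linearZr_LR/=; ring.
have [_ /eqP] := ab _ _ v0; rewrite oppr_eq0 => /eqP na.
exists a; split => //; apply/eqP => a0.
have [] := ab 1 0; first by rewrite a0 scaler0 scale0r addr0.
by move=> /eqP; rewrite oner_eq0.
Qed.

Lemma orthonormal_norm_sqr {R : realType} {X : normedModType R}
    (dot : {dot X for idfun}) (n v : X) (a b : R) :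
  (forall x : X, `|x| ^+ 2 = dot x x) -> `|n| = 1 -> `|v| = 1 ->
  dot n v = 0 -> `|a *: n + b *: v| ^+ 2 = a ^+ 2 + b ^+ 2.
Proof.
move=> nd n1 v1 nv.
have vn : dot v n = 0.
  by rewrite [LHS](hermC dot v n : _ = (-1) ^+ false * dot n v) nv mulr0.
have nn : dot n n = 1 by rewrite -nd n1 expr1n.
have vv : dot v v = 1 by rewrite -nd v1 expr1n.
rewrite nd linearDl !linearDr !linearZl_LR !linearZr_LR /= nn vv nv vn.
by rewrite /GRing.scale/=; ring.
Qed.

(** Here r is the distance from p to the complement of Omega.  The endpoints
    p + al n +- (l / 2) v, with n and v orthonormal and al = r - l^2 / (4 r),
    satisfy al^2 + (l / 2)^2 < r^2, so they are in Omega; their midpoint is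
    l^2 / (4 r) away from the point p + r n, next to which, for a suitable
    direction n, there are points outside Omega. *)
Lemma midpoint_balls_le_of_interior {R : realType} {X : normedModType R}
    (dot : {dot X for idfun}) (Omega : set X) (p : X) (r0 : R) :
  (forall x : X, `|x| ^+ 2 = dot x x) -> dim_ge2 X ->
  Omega <> setT -> 0 < r0 -> closed_ball_ Num.norm p r0 `<=` Omega ->
  exists2 r, 0 < r & forall l d, 0 < l -> l < r ->
    midpoint_balls Omega l d -> d <= l ^+ 2 / (4 * r).
Proof.
move=> nd dimX OT r00 pO.
have [q Oq] : exists q, ~ Omega q.
  apply/existsNP => H; apply: OT; rewrite predeqE => x; split=> // _; exact: H.
pose D := [set `|p - w| | w in ~` Omega].
have D0 : D !=set0 by exists `|p - q|; exists q.
have Dlb : lbound D r0.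
  move=> _ [w Ow <-]; rewrite leNgt; apply/negP => /ltW wr.
  by apply: Ow; exact: pO.
have Dinf : has_inf D by split => //; exists r0.
pose r := inf D.
have r_0 : 0 < r by apply: lt_le_trans r00 _; exact: lb_le_inf.
have rO w : `|p - w| < r -> Omega w.
  move=> wr; apply: contrapT => Ow.
  have : r <= `|p - w| by apply: ge_inf; [case: Dinf|exists w].
  by rewrite leNgt wr.
exists r => // l d l0 lr Hl; rewrite leNgt; apply/negP => dl.
have [_ [w Ow <-] wr] : exists2 x, D x & x < r + (d - l ^+ 2 / (4 * r)).
  by apply: inf_adherent => //; rewrite subr_gt0.
have rw : r <= `|p - w| by apply: ge_inf; [case: Dinf|exists w].
have w0 : 0 < `|p - w| by exact: lt_le_trans rw.
pose n := `|p - w|^-1 *: (w - p).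
have n1 : `|n| = 1.
  by rewrite normrZ normfV normr_id (distrC w) mulVf// gt_eqF.
have wE : w = p + `|p - w| *: n.
  by rewrite scalerA divff ?gt_eqF// scale1r addrC subrK.
clearbody n.
have [v [v1 nv]] := exists_orthogonal_unit dot n nd dimX.
pose al := r - l ^+ 2 / (4 * r).
have rl : l ^+ 2 / (4 * r) < r / 4.
  by rewrite ltr_pdivrMr ?mulr_gt0//; nra.
have h0 : 0 < l ^+ 2 / (4 * r) by rewrite divr_gt0 ?exprn_gt0 ?mulr_gt0.
have onball b : b ^+ 2 = l ^+ 2 / 4 -> Omega (p + (al *: n + b *: v)).
  move=> bl; apply: rO; rewrite opprD addNKr normrN.
  rewrite -ltr_sqr ?nnegrE// ?(ltW r_0)// (orthonormal_norm_sqr dot)//.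
  have : l ^+ 2 = l ^+ 2 / (4 * r) * (4 * r).
    by rewrite divfK// gt_eqF// mulr_gt0.
  move: bl; rewrite /al; set h := l ^+ 2 / (4 * r) in rl h0 *.
  move=> bl lh; rewrite lh in bl.
  by nra.
apply: Ow; apply: (Hl (p + (al *: n + (l / 2) *: v))
                      (p + (al *: n + (- (l / 2)) *: v))).
- by apply: onball; field.
- by apply: onball; field.
- rewrite opprD addrACA subrr add0r opprD addrACA subrr add0r scaleNr opprK.
  by rewrite -scalerDl normrZ v1 mulr1 ger0_norm; [field|lra].
- have -> : 2^-1 *: (p + (al *: n + (l / 2) *: v) +
                     (p + (al *: n + (- (l / 2)) *: v))) = p + al *: n.
    rewrite !(addrA p) addrACA scaleNr subrr addr0 -mulr2n.
    by rewrite -(scaler_nat 2 (p + _)) scalerA mulVf ?scale1r// pnatr_eq0.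
  rewrite /closed_ball_/= {1}wE opprD addrACA subrr add0r -scalerBl normrZ n1.
  rewrite mulr1 distrC ger0_norm /al; lra.
Qed.

(** A set without interior has no positive margin at any scale at which it
    has chords, and a convex set with two points has chords at all small
    scales. *)
Lemma midpoint_balls_le_sqr {R : realType} {X : normedModType R}
    (dot : {dot X for idfun}) (Omega : set X) :
  (forall x : X, `|x| ^+ 2 = dot x x) -> dim_ge2 X -> convex_set Omega ->
  Omega <> setT -> (exists x y : X, [/\ Omega x, Omega y & x <> y]) ->
  exists M l0 : R, 0 < l0 /\ forall l d, 0 < l -> l < l0 ->
    midpoint_balls Omega l d -> d <= M * l ^+ 2.
Proof.
move=> nd dimX cO OT [a [b [Oa Ob ab]]].
have [[p [r0 [r00 pO]]]|noint] :=
    pselect (exists p r0, 0 < r0 /\ closed_ball_ Num.norm p r0 `<=` Omega).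
  have [r r_0 Hr] := midpoint_balls_le_of_interior dot Omega p r0 nd
    dimX OT r00 pO.
  exists (4 * r)^-1, r; split=> // l d l0 lr /(Hr _ _ l0 lr).
  by rewrite mulrC.
exists 0, `|a - b|; split.
  by rewrite normr_gt0 subr_eq0; exact/eqP.
move=> l d l0 lab Hl; rewrite mul0r leNgt; apply/negP => d0.
apply: noint; exists (2^-1 *: (a + b)), d; split => //.
by apply: (midpoint_balls_longer Omega l d) => //; exact: ltW.
Qed.

(** * The modulus of convexity and its limit *)

Lemma le_modulus_of_convexity {R : realType} {X : normedModType R}
    (Omega : set X) (e d : R) :
  0 <= d -> midpoint_balls Omega e d ->
  (d%:E <= modulus_of_convexity Omega e)%E.
Proof. by move=> d0 He; apply: ereal_sup_ubound; exists d. Qed.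

Lemma modulus_of_convexity_le {R : realType} {X : normedModType R}
    (Omega : set X) (e b : R) :
  ~ midpoint_balls Omega e b -> (modulus_of_convexity Omega e <= b%:E)%E.
Proof.
move=> Hb; apply: ge_ereal_sup => _ [d [d0 Hd] <-].
rewrite lee_fin leNgt; apply/negP => /ltW bd.
by apply: Hb; exact: midpoint_balls_le Hd.
Qed.

Lemma cvge_of_bounds {R : realType} {T : Type} (F : set_system T)
    {FF : Filter F} (f : T -> \bar R) (l : R) :
  (forall c, c < l -> \forall x \near F, (c%:E <= f x)%E) ->
  (forall c, l < c -> \forall x \near F, (f x <= c%:E)%E) ->
  f x @[x --> F] --> l%:E.
Proof.
move=> lo up.
have close eps : 0 < eps ->
    \forall x \near F, ((l - eps)%:E <= f x)%E /\ (f x <= (l + eps)%:E)%E.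
  by move=> e0; apply: filterS2 (lo (l - eps) _) (up (l + eps) _) => //; lra.
apply/fine_cvgP; split.
  apply: filterS (close 1 ltr01) => x [].
  by case: (f x) => [r| |]//=; rewrite ?leeNy_eq ?leye_eq.
apply/cvgrPdist_le => eps e0; apply: filterS (close eps e0) => x [] /=.
case: (f x) => [r| |]//=; rewrite ?leeNy_eq ?leye_eq// !lee_fin => lr rl.
by rewrite ler_norml; apply/andP; split; lra.
Qed.

Theorem theorem2p1 (R : realType) (X : completeNormedModType R)
    (* X is a Hilbert space: its norm comes from an inner product *)
    (dot : {dot X for idfun})
    (norm_dot : forall x : X, `|x| ^+ 2 = dot x x)
    (dimX : dim_ge2 X)
    (Omega : set X)
    (Omega_closed : closed Omega)
    (Omega_convex : convex_set Omega)
    (Omega_neqT : Omega <> setT)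
    (* Omega is neither empty nor a singleton: otherwise the modulus is +oo
       at every e > 0 *)
    (Omega_two_points : exists x y : X, [/\ Omega x, Omega y & x <> y]) :
  exists l : R,
    (modulus_of_convexity Omega e / (e ^+ 2)%:E)%E @[e --> 0^'+] --> l%:E.
Proof.
(* sup S is the upper limit of the ratio *)
pose S := [set c : R | 0 <= c /\ frequent_margin Omega c].
have S0 : S 0.
  split=> // eta eta0; exists (eta / 2); split; [lra|lra|].
  by rewrite mul0r; exact: midpoint_balls0.
have Ssup : has_sup S.
  split; first by exists 0.
  have [M [l0 [l00 HM]]] := midpoint_balls_le_sqr dot Omega norm_dot dimX
    Omega_convex Omega_neqT Omega_two_points.
  exists M => c [c0 /(_ l0 l00)[e [e0 el /HM]]].
  by move=> /(_ e0 el); rewrite ler_pM2r// exprn_gt0.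
have supS0 : 0 <= sup S by exact: (sup_upper_bound Ssup).
have divE (e : R) : 0 < e -> ((e ^+ 2)%:E^-1)%E = ((e ^+ 2)^-1)%:E.
  by move=> e0; rewrite inver gt_eqF// exprn_gt0.
exists (sup S); apply: cvge_of_bounds => c cS.
- have [c0|c0] := leP c 0.
    near=> e; have e0 : 0 < e by near: e; exact: nbhs_right_gt.
    rewrite divE// lee_pdivlMr ?exprn_gt0// -EFinM.
    apply: (@le_trans _ _ 0%:E); last first.
      by apply: le_modulus_of_convexity => //; exact: midpoint_balls0.
    by rewrite lee_fin mulr_le0_ge0// sqr_ge0.
  have [c1 [c10 Hc1] cc1] : exists2 c1, S c1 & c < c1.
    have [c1 Sc1 c1c] := sup_adherent (ltac:(lra) : 0 < sup S - c) Ssup.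
    by exists c1 => //; lra.
  have [eta eta0 Heta] := midpoint_balls_eventually Omega c c1 Omega_convex
    Hc1 c0 cc1.
  near=> e; have e0 : 0 < e by near: e; exact: nbhs_right_gt.
  rewrite divE// lee_pdivlMr ?exprn_gt0// -EFinM.
  apply: le_modulus_of_convexity.
    by rewrite mulr_ge0 ?sqr_ge0// ltW.
  by apply: Heta => //; near: e; exact: nbhs_right_lt.
- have [eta eta0 Heta] : exists2 eta, 0 < eta &
      forall e, 0 < e -> e < eta -> ~ midpoint_balls Omega e (c * e ^+ 2).
    apply: contrapT => nH.
    suff Sc : S c by have := sup_upper_bound Ssup Sc; rewrite leNgt cS.
    split=> [|eta eta0]; first by lra.
    apply: contrapT => nfreq; apply: nH; exists eta => // e e0 ee He.
    by apply: nfreq; exists e.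
  near=> e; have e0 : 0 < e by near: e; exact: nbhs_right_gt.
  rewrite divE// lee_pdivrMr ?exprn_gt0// -EFinM.
  apply: modulus_of_convexity_le.
  by apply: Heta => //; near: e; exact: nbhs_right_lt.
Unshelve. all: by end_near. Qed.
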